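(* Let $n\ge 1$ and let $P(z)=z^n+a_{n-2}z^{n-2}+\dots+a_1z+a_0\in\mathbb{C}[z]$ be a normalized polynomial of degree $n$. Then $P\in\overline{\mathbb{Q}}[z]$ if and only if $B_P\subset\overline{\mathbb{Q}}$.
   Context: $\overline{\mathbb{Q}}\subset\mathbb{C}$ denotes the field of algebraic numbers. A critical point of $P$ is a $\zeta\in\mathbb{C}$ with $P'(\zeta)=0$; a critical value is $P(\zeta)$ for a critical point $\zeta$; $B_P$ denotes the (finite) set of critical values of $P$. A polynomial of degree $n$ is called normalized if it is monic and its coefficient of $z^{n-1}$ is $0$. *)

(* Defs.v *)
From HB Require Import structures.
From mathcomp Require Import all_boot all_order all_algebra.
From mathcomp Require Import complex.
From mathcomp Require Import reals.
Set Implicit Arguments. Unset Strict Implicit. Unset Printing Implicit Defensive.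
Import Order.TTheory GRing.Theory Num.Theory.
Local Open Scope ring_scope.

Definition algebraicC (R : realType) (z : R[i]) : Prop :=
  exists2 p : {poly rat}, p != 0 & root (map_poly ratr p) z.

Definition normalized (R : realType) (n : nat) (P : {poly R[i]}) : Prop :=
  [/\ P \is monic, size P = n.+1 & P`_n.-1 = 0].

Definition critical_value (R : realType) (P : {poly R[i]}) (w : R[i]) : Prop :=
  exists zeta : R[i], root P^`() zeta /\ w = P.[zeta].

(* Main.v *)
(**
If a coefficient of [P] were transcendental, some derivation [D] with values in
the ambient field would send it to [1]; [D] can be defined on a subring
containing all the coefficients and critical points of [P].  Let [Q] be the
polynomial obtained by applying [D] to the coefficients of [P].  If [z] is a
zero of [P'] of order [k], then [P - P(z)] is divisible by [(X - z)^(k+1)];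
since [D] kills the algebraic number [P(z)], applying [D] to this
factorization shows that [(X - z)^k] divides [Q].  Hence [P'] divides [Q].
As [P] is normalized, [Q] has degree at most [n - 2], so [Q = 0],
a contradiction.
*)

Require Import Defs.
From HB Require Import structures.
From mathcomp Require Import all_boot all_order all_algebra.
From mathcomp Require Import complex.
From mathcomp Require Import reals.
From mathcomp Require Import boolp ring.
Import Order.TTheory GRing.Theory Num.Theory.
Local Open Scope ring_scope.

(** * Derivations as graphs, and their action on coefficients *)

Section DerivationGraph.
Set Implicit Arguments.
Unset Strict Implicit.
Variable F : numFieldType.
Implicit Types (G : F -> F -> Prop) (p q f g h : {poly F}) (x u v w : F).

(* The graph of a partial derivation is a subring of the dual numbers over [F],
   [G a b] standing for [a + b e]. *)
Record derivation_graph G : Prop := DerivationGraph {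
  dgraph_ratr : forall a : rat, G (ratr a) 0;
  dgraphB : forall a b c d, G a b -> G c d -> G (a - c) (b - d);
  dgraphM : forall a b c d, G a b -> G c d -> G (a * c) (a * d + b * c);
  dgraph0_eq0 : forall v, G 0 v -> v = 0 }.

(** Here [q] is [p] with the derivation applied to its coefficients; the variable counts as a
    constant. *)
Definition poly_graph G p q := forall i, G p`_i q`_i.

Section Closure.
Variable G : F -> F -> Prop.
Hypothesis dG : derivation_graph G.

Lemma dgraph0 : G 0 0.
Proof. by rewrite -{1}(rmorph0 (@ratr F)); apply: dgraph_ratr dG _. Qed.

Lemma dgraph1 : G 1 0.
Proof. by rewrite -{1}(rmorph1 (@ratr F)); apply: dgraph_ratr dG _. Qed.

Lemma dgraphD a b c d : G a b -> G c d -> G (a + c) (b + d).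
Proof.
move=> Gab Gcd; rewrite -[c]opprK -[d]opprK; apply: (dgraphB dG) => //.
by rewrite -(sub0r c) -(sub0r d); apply: (dgraphB dG) => //; apply: dgraph0.
Qed.

Lemma dgraph_unique x v w : G x v -> G x w -> v = w.
Proof.
move=> Gv Gw; apply/eqP; rewrite -subr_eq0; apply/eqP/(dgraph0_eq0 dG).
by rewrite -(subrr x); apply: (dgraphB dG).
Qed.

Lemma dgraph_sum (I : Type) (r : seq I) (a b : I -> F) :
  (forall i, G (a i) (b i)) -> G (\sum_(i <- r) a i) (\sum_(i <- r) b i).
Proof.
by move=> Gab; apply: (big_ind2 G); [apply: dgraph0 | move=> *; apply: dgraphD|].
Qed.

Lemma poly_graphD p q f g :
  poly_graph G p q -> poly_graph G f g -> poly_graph G (p + f) (q + g).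
Proof. by move=> Gpq Gfg i; rewrite !coefD; apply: dgraphD. Qed.

Lemma poly_graphB p q f g :
  poly_graph G p q -> poly_graph G f g -> poly_graph G (p - f) (q - g).
Proof. by move=> Gpq Gfg i; rewrite !coefB; apply: (dgraphB dG). Qed.

Lemma poly_graphM p q f g :
  poly_graph G p q -> poly_graph G f g -> poly_graph G (p * f) (p * g + q * f).
Proof.
move=> Gpq Gfg i; rewrite coefD !coefM -big_split.
by apply: dgraph_sum => j; apply: (dgraphM dG).
Qed.

Lemma poly_graphC x v : G x v -> poly_graph G x%:P v%:P.
Proof. by move=> Gxv [|i]; rewrite !coefC //=; apply: dgraph0. Qed.

Lemma poly_graphX : poly_graph G 'X 0.
Proof.
by move=> i; rewrite coefX coef0; case: (i == 1%N); [apply: dgraph1|apply: dgraph0].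
Qed.

Lemma poly_graph_deriv p q : poly_graph G p q -> poly_graph G p^`() q^`().
Proof.
move=> Gpq i; rewrite !coef_deriv -mulr_natr -(mulr_natr q`_i.+1).
have := dgraphM dG (Gpq i.+1) (dgraph_ratr dG i.+1%:R).
by rewrite ratr_nat mulr0 add0r.
Qed.

Lemma poly_graph0_eq0 q : poly_graph G 0 q -> q = 0.
Proof.
move=> G0q; apply/polyP=> i; rewrite coef0; apply: (dgraph0_eq0 dG).
by have := G0q i; rewrite coef0.
Qed.

Lemma poly_graph_unique p q g : poly_graph G p q -> poly_graph G p g -> q = g.
Proof. by move=> Gpq Gpg; apply/polyP => i; apply: dgraph_unique (Gpq i) (Gpg i). Qed.

(** Constant terms are peeled off [p] and [q] together, so that proofs can follow Horner's
    scheme. *)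
Lemma poly_graph_ind (K : {poly F} -> {poly F} -> Prop) :
  K 0 0 ->
  (forall p q c d, poly_graph G p q -> G c d -> K p q ->
    K (p * 'X + c%:P) (q * 'X + d%:P)) ->
  forall p q, poly_graph G p q -> K p q.
Proof.
move=> K0 KS; elim/poly_ind => [|p c IH] q.
  by move=> /poly_graph0_eq0 ->.
have step q' d : poly_graph G (p * 'X + c%:P) (q' * 'X + d%:P) ->
    K (p * 'X + c%:P) (q' * 'X + d%:P).
  move=> H; have Gcd : G c d.
    by have := H 0%N; rewrite !coefD !coefMX !coefC /= !add0r.
  have Gpq : poly_graph G p q'.
    by move=> i; have := H i.+1; rewrite !coefD !coefMX !coefC /= !addr0.
  exact: KS (IH _ Gpq).
elim/poly_ind: q => [|q d _]; last exact: step.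
(* A zero [q] is read as [0 * 'X + 0], which [step] covers. *)
by move=> H; have := step 0 0; rewrite mul0r addr0; apply.
Qed.

(** The chain rule: each Horner step is one use of the product rule. *)
Lemma dgraph_horner p q x v :
  poly_graph G p q -> G x v -> G p.[x] (q.[x] + p^`().[x] * v).
Proof.
move=> Gpq Gxv; elim/poly_graph_ind: p q / Gpq => [|p q c d _ Gcd IH].
  by rewrite !(deriv0, horner0) mul0r addr0; apply: dgraph0.
have := dgraphD (dgraphM dG IH Gxv) Gcd.
by rewrite !derivE !hornerE; congr (G _ _); ring.
Qed.

Lemma poly_graph_ex p : (forall i, exists v, G p`_i v) ->
  exists q, poly_graph G p q.
Proof.
elim/poly_ind: p => [|p c IH] Gp.
  by exists 0 => i; rewrite coef0; apply: dgraph0.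
have [|q Gpq] := IH.
  by move=> i; have := Gp i.+1; rewrite !coefD !coefMX !coefC /= !addr0.
have [d] := Gp 0%N; rewrite !coefD !coefMX !coefC /= !add0r => Gcd.
exists (q * 'X + d%:P); case=> [|i];
  by rewrite !coefD !coefMX !coefC /= ?addr0 ?add0r.
Qed.

(* By Horner's scheme, the coefficients of the quotient [h] stay in the domain
   of the derivation. *)
Lemma poly_graph_div_XsubC p q x v : poly_graph G p q -> G x v ->
  exists h g, [/\ poly_graph G h g & p = h * ('X - x%:P) + p.[x]%:P].
Proof.
move=> Gpq Gxv; elim/poly_graph_ind: p q / Gpq => [|p q c d Gpq Gcd [h [g [Ghg Ep]]]].
  exists 0, 0; split; last by rewrite mul0r horner0 addr0.
  by move=> i; rewrite coef0; apply: dgraph0.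
exists (h * 'X + p.[x]%:P), (h * 0 + g * 'X + (q.[x] + p^`().[x] * v)%:P); split.
  apply: poly_graphD; first exact: (poly_graphM Ghg poly_graphX).
  exact/poly_graphC/dgraph_horner.
rewrite !hornerE {1}Ep rmorphD rmorphM /=; ring.
Qed.

(** From [p = h * ('X - x%:P)] follows [q = h * (0 - v%:P) + g * ('X - x%:P)], so one application of
    the derivation costs at most one order of vanishing, by induction applied to [h] and [g]. *)
Lemma dvdp_exp_poly_graph k p q x v : poly_graph G p q -> G x v ->
  ('X - x%:P) ^+ k.+1 %| p -> ('X - x%:P) ^+ k %| q.
Proof.
move=> Gpq Gxv; elim: k p q Gpq => [|k IH] p q Gpq dvp; first by rewrite expr0 dvd1p.
have px0 : p.[x] = 0.
  apply/eqP; rewrite -rootE -dvdp_XsubCl; apply: dvdp_trans dvp.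
  by rewrite exprS dvdp_mulr.
have [h [g [Ghg Ep]]] := poly_graph_div_XsubC Gpq Gxv.
rewrite px0 addr0 in Ep.
have Gx : poly_graph G ('X - x%:P) (0 - v%:P).
  by apply: poly_graphB; [apply: poly_graphX | apply: poly_graphC].
have Gp := poly_graphM Ghg Gx; rewrite -Ep in Gp.
rewrite (poly_graph_unique Gpq Gp).
have dvh : ('X - x%:P) ^+ k.+1 %| h.
  by move: dvp; rewrite Ep exprSr dvdp_mul2r // polyXsubC_eq0.
apply: dvdp_add; first exact: dvdp_mulr.
by rewrite exprSr dvdp_mul //; apply: IH dvh.
Qed.

(** * Extending a derivation to further elements *)

Lemma minimal_poly_graph x p q : poly_graph G p q -> p != 0 -> root p x ->
  exists f g, [/\ poly_graph G f g, f != 0, root f x &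
    forall p q, poly_graph G p q -> p != 0 -> root p x -> (size f <= size p)%N].
Proof.
have [n] := ubnP (size p); elim: n p q => // n IH p q ltpn Gpq p0 rpx.
have [[f [g [Gfg f0 rfx ltfp]]]|minp] := EM (exists f g,
  [/\ poly_graph G f g, f != 0, root f x & (size f < size p)%N]).
  by apply: IH Gfg f0 rfx; apply: leq_trans ltfp _.
exists p, q; split=> // f g Gfg f0 rfx; rewrite leqNgt; apply/negP => ltfp.
by apply: minp; exists f, g.
Qed.

(** In characteristic zero the derivative of [f] is nonzero, smaller, and still has coefficients in
    the domain; vanishing at [x] would contradict minimality. *)
Lemma minimal_deriv_neq0 x f g : poly_graph G f g -> f != 0 -> root f x ->
  (forall p q, poly_graph G p q -> p != 0 -> root p x -> (size f <= size p)%N) ->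
  f^`().[x] != 0.
Proof.
move=> Gfg f0 rfx minf; apply/negP => rf'x.
have f'0 : f^`() != 0.
  have := root_size_gt1 f0 rfx; case Ef: (size f) => [|[|k]] // _.
  have: f`_k.+1 != 0 by rewrite -lead_coef_eq0 lead_coefE Ef in f0.
  apply: contraNneq => /(congr1 (fun s : {poly F} => s`_k)).
  by rewrite coef_deriv coef0 => /eqP; rewrite mulrn_eq0.
have := minf _ _ (poly_graph_deriv Gfg) f'0 rf'x.
by rewrite leqNgt lt_size_deriv.
Qed.

(** The candidate extension to the ring generated by [x], sending [x] to [u]; as a relation it may
    fail to be single-valued. *)
Definition dgraph_adjoin x u a b :=
  exists p q, [/\ poly_graph G p q, a = p.[x] & b = q.[x] + p^`().[x] * u].

Lemma dgraph_adjoin_sub x u a b : G a b -> dgraph_adjoin x u a b.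
Proof.
move=> Gab; exists a%:P, b%:P; rewrite derivC !hornerE.
by split=> //; apply: poly_graphC.
Qed.

Lemma dgraph_adjoin_gen x u : dgraph_adjoin x u x u.
Proof.
exists 'X, 0; rewrite derivX !hornerE; split=> //; first exact: poly_graphX.
Qed.

(** Only single-valuedness is in doubt, and the hypothesis says that every relation [p.[x] = 0] is
    respected. *)
Lemma dgraph_adjoinP x u :
  (forall p q, poly_graph G p q -> root p x -> q.[x] + p^`().[x] * u = 0) ->
  derivation_graph (dgraph_adjoin x u).
Proof.
move=> H; split.
- by move=> a; apply: dgraph_adjoin_sub; apply: dgraph_ratr dG _.
- move=> _ _ _ _ [p [q [Gpq -> ->]]] [f [g [Gfg -> ->]]].
  exists (p - f), (q - g); rewrite !derivE !hornerE.
  by split=> //; [apply: poly_graphB | ring].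
- move=> _ _ _ _ [p [q [Gpq -> ->]]] [f [g [Gfg -> ->]]].
  exists (p * f), (p * g + q * f); rewrite !derivE !hornerE.
  by split=> //; [apply: poly_graphM | ring].
- by move=> v [p [q [Gpq /esym/eqP px0 ->]]]; apply: H.
Qed.

(** If [x] is transcendental over the domain, the value 0 will do. Otherwise a polynomial [f] of
    least degree dictates the value, and other relations reduce to [f] by pseudo-division, as the
    domain need not be a field. *)
Lemma derivation_graph_extend x :
  exists G' u, [/\ derivation_graph G', forall a b, G a b -> G' a b & G' x u].
Proof.
have [[p [q [Gpq p0 rpx]]]|tr] :=
  EM (exists p q, [/\ poly_graph G p q, p != 0 & root p x]); last first.
  exists (dgraph_adjoin x 0), 0; split; last exact: dgraph_adjoin_gen.
    apply: dgraph_adjoinP => p q Gpq rpx.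
    have [p0|p0] := eqVneq p 0; last by case: tr; exists p, q.
    by rewrite p0 in Gpq *; rewrite (poly_graph0_eq0 Gpq) deriv0 !hornerE.
  by move=> a b; apply: dgraph_adjoin_sub.
have [f [g [Gfg f0 rfx minf]]] := minimal_poly_graph Gpq p0 rpx.
have f'x := minimal_deriv_neq0 Gfg f0 rfx minf.
(* Differentiating [f.[x] = 0] forces the value [u] at [x]. *)
have [u fu] : exists u, g.[x] + f^`().[x] * u = 0.
  by exists (- g.[x] / f^`().[x]); rewrite mulrC divfK // addrN.
exists (dgraph_adjoin x u), u; split; last exact: dgraph_adjoin_gen; last first.
  by move=> a b; apply: dgraph_adjoin_sub.
apply: dgraph_adjoinP => {p0 rpx Gpq} {}p {}q.
have [n] := ubnP (size p); elim: n p q => // n IH p q ltpn Gpq rpx.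
have [p0|p0] := eqVneq p 0.
  by rewrite p0 in Gpq *; rewrite (poly_graph0_eq0 Gpq) deriv0 !hornerE.
have lefp := minf _ _ Gpq p0 rpx.
(* Cancel the leading term of [p] against a multiple of [f]. *)
pose k := (size p - size f)%N.
have [h Gk] : exists h, poly_graph G 'X^k h.
  apply: poly_graph_ex => i; rewrite coefXn; exists 0.
  by case: (_ == _); [apply: dgraph1|apply: dgraph0].
have Gc1 := poly_graphC (Gfg (size f).-1).
have Gc2 := poly_graphC (Gpq (size p).-1).
have Gr := poly_graphB (poly_graphM Gc1 Gpq)
  (poly_graphM (poly_graphM Gc2 Gk) Gfg).
set r := (X in poly_graph G X _) in Gr.
have szr : (size r < size p)%N.
  rewrite (@leq_ltn_trans (size p).-1) ?prednK ?size_poly_gt0 //.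
  apply/leq_sizeP => j; rewrite leq_eqVlt => /orP[/eqP <-|ltj].
    rewrite /r coefB coefCM -mulrA coefCM coefXnM ltnNge.
    have -> : (k <= (size p).-1)%N.
      by rewrite /k -ltnS prednK ?size_poly_gt0 // ltn_subrL !size_poly_gt0 f0 p0.
    have -> : ((size p).-1 - k = (size f).-1)%N.
      by rewrite /k -!subn1 subnAC subKn.
    by rewrite /= mulrC subrr.
  have lepj : (size p <= j)%N by rewrite -(prednK (n:=size p)) ?size_poly_gt0.
  rewrite /r coefB coefCM -mulrA coefCM coefXnM.
  rewrite (nth_default 0 lepj) mulr0 ltnNge (leq_trans _ lepj) ?leq_subr //=.
  rewrite (@nth_default _ 0 f) ?mulr0 ?subr0 // leq_subRL; last first.
    by rewrite (leq_trans _ lepj) ?leq_subr.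
  by rewrite /k subnK.
have rrx : root r x.
  by rewrite rootE /r !hornerE (eqP rpx) (eqP rfx) !mulr0 subr0.
have := IH _ _ (leq_trans szr ltpn) Gr rrx.
rewrite /r !derivE !hornerE (eqP rpx) (eqP rfx) => E.
(* As [p] and [f] vanish at [x] and [f.[x]] has derivative 0, the induction hypothesis for [r]
   leaves only the contribution of [p], scaled by the leading coefficient of [f]. *)
have : f`_(size f).-1 * (q.[x] + p^`().[x] * u) = 0.
  rewrite -[RHS]E.
  have -> : g.[x] = - (f^`().[x] * u) by apply/eqP; rewrite -addr_eq0 fu.
  ring.
by move/eqP; rewrite mulf_eq0 -lead_coefE lead_coef_eq0 (negPf f0) => /eqP.
Qed.

End Closure.

Lemma derivation_graph_extend_seq (s : seq F) G : derivation_graph G ->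
  exists G', [/\ derivation_graph G', forall a b, G a b -> G' a b &
    forall x, x \in s -> exists v, G' x v].
Proof.
elim: s G => [|x s IH] G dG; first by exists G; split.
have [G1 [u [dG1 GG1 G1x]]] := derivation_graph_extend dG x.
have [G2 [dG2 G12 G2s]] := IH _ dG1.
exists G2; split=> // [a b /GG1/G12 //|y].
by rewrite inE => /predU1P[->|/G2s //]; exists u; apply: G12.
Qed.

(** * Derivations over the rationals *)

Definition rat_graph (a b : F) := exists2 r : rat, a = ratr r & b = 0.

Lemma rat_graphP : derivation_graph rat_graph.
Proof.
split.
- by move=> a; exists a.
- by move=> _ _ _ _ [r -> ->] [s -> ->]; exists (r - s); rewrite ?rmorphB ?subr0.
- move=> _ _ _ _ [r -> ->] [s -> ->]; exists (r * s); rewrite ?rmorphM //.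
  by rewrite mul0r mulr0 addr0.
- by move=> v [].
Qed.

Lemma rat_poly_graph p q : poly_graph rat_graph p q ->
  exists2 r : {poly rat}, p = map_poly ratr r & q = 0.
Proof.
move=> Gpq; elim/(poly_graph_ind rat_graphP): p q / Gpq => [|p q c d _].
  by exists 0; rewrite ?rmorph0.
move=> [a -> ->] [r -> ->]; exists (r * 'X + a%:P); last by rewrite mul0r addr0.
by rewrite [RHS]rmorphD [in RHS]rmorphM /= map_polyX map_polyC.
Qed.

Lemma poly_graph_map_ratr (r : {poly rat}) :
  poly_graph rat_graph (map_poly ratr r) 0.
Proof. by move=> i; rewrite coef_map coef0; exists r`_i. Qed.

(** Differentiating [f.[w] = 0], for [f] of least degree over the rationals, gives f'(w) v = 0 with
    f'(w) nonzero. *)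
Lemma dgraph_algebraic G w v : derivation_graph G ->
  algebraicOver (ratr : rat -> F) w -> G w v -> v = 0.
Proof.
move=> dG [r r0 rw] Gwv.
have rr0 : map_poly ratr r != 0 :> {poly F} by rewrite map_poly_eq0.
have [f [g [Gfg f0 rfw minf]]] := minimal_poly_graph (poly_graph_map_ratr r) rr0 rw.
have f'w := minimal_deriv_neq0 rat_graphP Gfg f0 rfw minf.
have [s _ g0] := rat_poly_graph Gfg.
have GG a b : rat_graph a b -> G a b.
  by case=> c -> ->; apply: dgraph_ratr dG _.
have := dgraph_horner dG (fun i => GG _ _ (Gfg i)) Gwv.
rewrite g0 horner0 add0r (eqP rfw) => /(dgraph0_eq0 dG)/eqP.
by rewrite mulf_eq0 (negPf f'w) => /eqP.
Qed.

(** On the ring generated by [a] over the rationals, differentiation with respect to [a] is well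
    defined, since [a] satisfies no relation. It is then extended to the finitely many elements of
    [s]. *)
Lemma transcendental_derivation a (s : seq F) :
  ~ algebraicOver (ratr : rat -> F) a ->
  exists G, [/\ derivation_graph G, G a 1 & forall x, x \in s -> exists v, G x v].
Proof.
move=> tra.
have dG : derivation_graph (dgraph_adjoin rat_graph a 1).
  apply: (dgraph_adjoinP rat_graphP) => p q /rat_poly_graph[r Ep ->] rpa.
  have [r0|r0] := eqVneq r 0; last by case: tra; exists r; rewrite -?Ep.
  by rewrite Ep r0 rmorph0 deriv0 !hornerE.
have [G [dG' GG' Gs]] := derivation_graph_extend_seq s dG.
by exists G; split=> //; apply/GG'/dgraph_adjoin_gen/rat_graphP.
Qed.

End DerivationGraph.

(** * Divisibility and multiplicities of roots *)

Section Multiplicities.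
Set Implicit Arguments.
Unset Strict Implicit.
Variable F : closedFieldType.
Implicit Types p q : {poly F}.

(** Cancel a common factor ['X - x%:P] and induct. The hypothesis passes to the quotients: at [x]
    the exponent shifts by one, and elsewhere the powers are coprime to the cancelled factor. *)
Lemma dvdp_by_multiplicity p q : p != 0 ->
  (forall x k, ('X - x%:P) ^+ k %| p -> ('X - x%:P) ^+ k %| q) -> p %| q.
Proof.
have [n] := ubnP (size p); elim: n p q => // n IH p q ltpn p0 H.
have [p1|/closed_rootP[x rpx]] := eqVneq (size p) 1%N.
  by rewrite (eqp_dvdl _ (_ : p %= 1)) ?dvd1p // -size_poly_eq1 p1.
have /dvdpP[p1 Ep] : 'X - x%:P %| p by rewrite dvdp_XsubCl.
have /dvdpP[q1 Eq] : 'X - x%:P %| q.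
  by rewrite -['X - _]expr1; apply: H; rewrite expr1 dvdp_XsubCl.
have p10 : p1 != 0 by apply: contraNneq p0 => p10; rewrite Ep p10 mul0r.
have X0 : 'X - x%:P != 0 by rewrite polyXsubC_eq0.
rewrite Ep Eq dvdp_mul2r //; apply: IH => //.
  by move: ltpn; rewrite Ep size_mul // size_XsubC addn2.
move=> y k; have [->|neq] := eqVneq y x.
  by move: (H x k.+1); rewrite Ep Eq exprSr !dvdp_mul2r.
have co : coprimep (('X - y%:P) ^+ k) ('X - x%:P).
  by apply: coprimep_expl; apply: coprimep_XsubC2; rewrite subr_eq0 eq_sym.
by have := H y k; rewrite Ep Eq !Gauss_dvdpl.
Qed.

Hypothesis F0 : forall n, n.+1%:R != 0 :> F.

Lemma dvdp_exp_deriv p x k : ('X - x%:P) ^+ k %| p^`() ->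
  ('X - x%:P) ^+ k.+1 %| p - p.[x]%:P.
Proof.
set r := p - _.
have [j [s]] := multiplicity_XsubC r x.
have [-> _ _ _|r0 /= sx Er] := eqVneq r 0; first exact: dvdp0.
have -> : p^`() = r^`() by rewrite /r derivB derivC subr0.
have rx : r.[x] = 0 by rewrite /r !hornerE subrr.
case: j Er => [|j] Er.
  by move: rx; rewrite Er mulr1 => /eqP; rewrite -rootE (negPf sx).
have X0 : 'X - x%:P != 0 by rewrite polyXsubC_eq0.
have Ed : r^`() = (s^`() * ('X - x%:P) + s *+ j.+1) * ('X - x%:P) ^+ j.
  rewrite {1}Er derivM deriv_exp derivXsubC mul1r /=.
  by rewrite mulrDl mulrnAr mulrnAl -mulrA -exprS exprSr.
have [lekj|ltjk] := leqP k j.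
  by rewrite Er => _; rewrite dvdp_mull // dvdp_exp2l.
(* If [j < k], cancelling the [j]-th power of ['X - x%:P] and evaluating at [x] would give (j+1)
   s(x) = 0. *)
move=> /(dvdp_trans (dvdp_exp2l _ ltjk)); rewrite Ed.
rewrite exprS dvdp_mul2r ?expf_neq0 // dvdp_XsubCl rootE !hornerE subrr mulr0 add0r.
by rewrite hornerMn -mulr_natr mulf_eq0 -rootE (negPf sx) (negPf (F0 j)).
Qed.

End Multiplicities.

(** * Algebraicity of roots and values of polynomials *)

Lemma algebraic_root (F : numFieldType) (p : {poly F}) (x : F) : p != 0 ->
  (forall k, algebraicOver (ratr : rat -> F) p`_k) -> root p x ->
  algebraicOver (ratr : rat -> F) x.
Proof.
move=> p0 algp px; apply/integral_algebraic/(integral_root p0 px) => _ /(nthP 0)[i _ <-].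
exact/integral_algebraic.
Qed.

Lemma algebraic_horner (F : numFieldType) (p : {poly F}) (x : F) :
  (forall k, algebraicOver (ratr : rat -> F) p`_k) ->
  algebraicOver (ratr : rat -> F) x -> algebraicOver (ratr : rat -> F) p.[x].
Proof.
move=> + algx; elim/poly_ind: p => [_|p c IH algp].
  by rewrite horner0; apply: algebraic0.
rewrite !hornerE; apply: algebraic_add.
  apply: algebraic_mul => //; apply: IH => i.
  by have := algp i.+1; rewrite coefD coefMX coefC /= addr0.
by have := algp 0%N; rewrite coefD coefMX coefC /= add0r.
Qed.

(** * Critical values and coefficients *)

Section CriticalValues.
Set Implicit Arguments.
Unset Strict Implicit.
Variable F : numClosedFieldType.
Implicit Types P : {poly F}.

Lemma size_deriv_num P : size P^`() = (size P).-1.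
Proof.
have [->|P0] := eqVneq P 0; first by rewrite deriv0 size_poly0.
apply/eqP; rewrite eqn_leq -ltnS prednK ?size_poly_gt0 // lt_size_deriv //=.
case Ek: (size P) => [|[|k]] //=; rewrite ltnNge; apply/negP => /leq_sizeP/(_ k (leqnn _)).
apply/eqP; rewrite coef_deriv mulrn_eq0 /=.
by rewrite -lead_coef_eq0 lead_coefE Ek in P0.
Qed.

Lemma algebraic_critical_value P z : P^`() != 0 ->
  (forall k, algebraicOver (ratr : rat -> F) P`_k) -> root P^`() z ->
  algebraicOver (ratr : rat -> F) P.[z].
Proof.
move=> P'0 algP rz; apply: algebraic_horner => //.
apply: algebraic_root rz => // k; rewrite coef_deriv -mulr_natr.
by apply: algebraic_mul => //; rewrite -(ratr_nat F); apply: algebraic_id.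
Qed.

Lemma algebraic_coef_of_critical_values n P :
  P \is monic -> size P = n.+1 -> P`_n.-1 = 0 -> (0 < n)%N ->
  (forall z, root P^`() z -> algebraicOver (ratr : rat -> F) P.[z]) ->
  forall k, algebraicOver (ratr : rat -> F) P`_k.
Proof.
move=> monP szP Pn n0 crit k; have [//|tr] := EM (algebraicOver (ratr : rat -> F) P`_k).
have szP' : size P^`() = n by rewrite size_deriv_num szP.
have P'0 : P^`() != 0 by rewrite -size_poly_gt0 szP'.
have [rs Ers] := closed_field_poly_normal P^`().
(* The domain must also contain the critical points, since the factors ['X - z%:P] get
   differentiated. *)
have [G [dG Ga Gs]] := transcendental_derivation ((P : seq F) ++ rs) tr.
have [Q GPQ] : exists Q, poly_graph G P Q.
  apply: (poly_graph_ex dG) => i; have [lti|lei] := ltnP i (size P).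
    by apply: Gs; rewrite mem_cat mem_nth.
  by exists 0; rewrite nth_default //; apply: dgraph0.
have Q1 i : P`_i = 0 -> Q`_i = 0.
  by move=> Pi; have := GPQ i; rewrite Pi => /(dgraph0_eq0 dG).
(* Normalization kills the coefficient of index [n.-1]; at index [n] the leading coefficient 1 has
   derivative 0. *)
have szQ : (size Q < n)%N.
  rewrite -(prednK n0) ltnS; apply/leq_sizeP => j.
  rewrite leq_eqVlt => /orP[/eqP <-|]; first exact: Q1.
  rewrite prednK // leq_eqVlt => /orP[/eqP <-|ltnj].
    apply: (dgraph_unique dG (GPQ n)).
    have -> : P`_n = 1 by move/monicP: monP; rewrite lead_coefE szP.
    exact: dgraph1.
  by apply: Q1; rewrite nth_default // szP.
have dvQ : P^`() %| Q.
  apply: dvdp_by_multiplicity => // z [|m] dvz; first by rewrite expr0 dvd1p.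
  have rz : root P^`() z.
    by rewrite -dvdp_XsubCl; apply: dvdp_trans dvz; rewrite exprS dvdp_mulr.
  have [v Gz] : exists v, G z v.
    apply: Gs; rewrite mem_cat; apply/orP; right.
    by move: rz; rewrite Ers rootZ ?lead_coef_eq0 // root_prod_XsubC.
  have Gw := dgraph_horner dG GPQ Gz.
  (* The critical value is algebraic, so its derivative is 0 and subtracting it from [P] does not
     change [Q]. *)
  have Gw0 := Gw; rewrite (dgraph_algebraic dG (crit _ rz) Gw) in Gw0.
  have := poly_graphB dG GPQ (poly_graphC dG Gw0).
  rewrite subr0 => GPw; apply: (dvdp_exp_poly_graph dG GPw Gz).
  by apply: dvdp_exp_deriv dvz => i; rewrite pnatr_eq0.
have Q0 : Q = 0.
  (* A nonzero multiple of the derivative of [P] has size at least [n]. *)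
  by apply/eqP; apply: contraTT szQ => Q0; rewrite -leqNgt -szP' dvdp_leq.
have := GPQ k; rewrite Q0 coef0 => Ga0.
by have /eqP := dgraph_unique dG Ga Ga0; rewrite oner_eq0.
Qed.

End CriticalValues.

Theorem mainTheorem1 (R : realType) (n : nat) (P : {poly R[i]}) :
  (1 <= n)%N -> normalized n P ->
  ((forall k : nat, algebraicC P`_k) <->
   (forall w : R[i], critical_value P w -> algebraicC w)).
Proof.
move=> n0 [monP szP Pn]; split=> [algP w [z [rz ->]]|crit].
  apply: algebraic_critical_value => //.
  by rewrite -size_poly_gt0 size_deriv_num szP.
apply: (algebraic_coef_of_critical_values monP szP) => // z rz.
by apply: crit; exists z.
Qed.
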